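(* Let $R$ be a binary relation on $\mathbb{N}$ with ${<}\subseteq R\subseteq{\leqslant}$, and let $L$ be a logic (set of formulas) such that $\mathbf{L}(\mathbb{N}, R) \subseteq L \subseteq \mathbf{L}_{c}(\mathbb{N}, R)$. Then satisfiability for $L$ is $\Sigma^1_1$-hard in languages with two individual variables, one monadic predicate letter and one proposition letter; that is, the set of formulas $\varphi$ containing only two individual variables, a single monadic predicate letter and a single proposition letter, with $\neg\varphi\notin L$, is $\Sigma^1_1$-hard.
   Context: First-order (predicate) modal language: countably many individual variables, predicate letters of every arity (nullary ones are proposition letters), no constants or function symbols, $\bot$, $\to$, $\Box$, $\forall$; other connectives, $\exists$ and $\Diamond$ defined as usual. A Kripke frame is $\langle W,R\rangle$ with $W\neq\varnothing$, $R\subseteq W\times W$. A predicate frame with expanding domains over it is $\langle W,R,D\rangle$ with non-empty sets $D_w$ ($w\in W$) such that $wRw'$ implies $D_w\subseteq D_{w'}$; it has constant domain if all $D_w$ coincide. A model $\langle W,R,D,I\rangle$ assigns to each world $w$ and $n$-ary letter $P$ a relation $I(w,P)\subseteq D_w^n$. Truth under an assignment $g$: atoms via $I(w,\cdot)$; Boolean connectives classically; $w\models^g\Box\varphi$ iff $v\models^g\varphi$ for all $v$ with $wRv$; $w\models^g\forall x\,\varphi$ iff $w\models^{g'}\varphi$ for all $x$-variants $g'$ of $g$ with $g'(x)\in D_w$. A formula is true at $w$ if true under every assignment sending its free variables into $D_w$. $\mathbf{L}(W,R)$ is the set of formulas true at every world of every model based on every predicate frame with expanding domains over $\langle W,R\rangle$;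 $\mathbf{L}_c(W,R)$ is the set of formulas true at every world of every model based on every predicate frame with constant domain over $\langle W,R\rangle$. For a logic $L$, satisfiability for $L$ is the set of $\varphi$ with $\neg\varphi\notin L$. $<$ and $\leqslant$ are the usual strict and non-strict orders on $\mathbb{N}$. *)

(* Defs.v *)
From mathcomp Require Import all_boot.

Set Implicit Arguments.
Unset Strict Implicit.
Unset Printing Implicit Defensive.

(* Individual variables are natural numbers.  A predicate letter is a pair
   (arity, index), so that there are countably many letters of each arity;
   [Atom n i xs] is the i-th n-ary letter applied to the n variables xs. *)
Definition letter : Type := (nat * nat)%type.

Inductive formula : Type :=
| Bot
| Atom (n i : nat) (xs : n.-tuple nat)
| Imp (phi psi : formula)
| Box (phi : formula)
| All (x : nat) (phi : formula).

Definition Neg (phi : formula) : formula := Imp phi Bot.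

Fixpoint free_vars (phi : formula) : seq nat :=
  match phi with
  | Bot => [::]
  | Atom _ _ xs => xs
  | Imp phi psi => free_vars phi ++ free_vars psi
  | Box phi => free_vars phi
  | All x phi => [seq y <- free_vars phi | y != x]
  end.

(* All variables occurring, free or bound. *)
Fixpoint vars (phi : formula) : seq nat :=
  match phi with
  | Bot => [::]
  | Atom _ _ xs => xs
  | Imp phi psi => vars phi ++ vars psi
  | Box phi => vars phi
  | All x phi => x :: vars phi
  end.

Fixpoint letters (phi : formula) : seq letter :=
  match phi with
  | Bot => [::]
  | Atom n i _ => [:: (n, i)]
  | Imp phi psi => letters phi ++ letters psi
  | Box phi => letters phi
  | All _ phi => letters phi
  end.

(* The language with the individual variables x and y, the i-th monadic letter
   and the j-th proposition letter. *)
Definition in_language (x y i j : nat) (phi : formula) : Prop :=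
  {subset vars phi <= [:: x; y]} /\
  {subset letters phi <= [:: (1, i); (0, j)]}.

(* The domains are subsets of a common carrier type. *)
Record pred_frame (W : Type) (R : W -> W -> Prop) := PredFrame {
  carrier : Type;
  dom : W -> carrier -> Prop;
  dom_nonempty : forall w, exists a, dom w a;
  dom_expanding : forall w w', R w w' -> forall a, dom w a -> dom w' a
}.

Definition constant_domain (W : Type) (R : W -> W -> Prop)
    (F : pred_frame R) : Prop :=
  forall (w w' : W) (a : carrier F), dom w a <-> dom w' a.

Record model (W : Type) (R : W -> W -> Prop) (F : pred_frame R) := Model {
  interp : W -> forall n : nat, nat -> n.-tuple (carrier F) -> Prop;
  interp_dom : forall (w : W) (n i : nat) (t : n.-tuple (carrier F)),
    interp w i t -> forall k : 'I_n, dom w (tnth t k)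
}.

Fixpoint holds (W : Type) (R : W -> W -> Prop) (F : pred_frame R)
    (M : model F) (w : W) (g : nat -> carrier F) (phi : formula) : Prop :=
  match phi with
  | Bot => False
  | Atom n i xs => interp M w i (map_tuple g xs)
  | Imp phi psi => holds M w g phi -> holds M w g psi
  | Box phi => forall v, R w v -> holds M v g phi
  | All x phi => forall g' : nat -> carrier F,
      (forall y, y <> x -> g' y = g y) -> dom w (g' x) -> holds M w g' phi
  end.

Definition true_at (W : Type) (R : W -> W -> Prop) (F : pred_frame R)
    (M : model F) (w : W) (phi : formula) : Prop :=
  forall g : nat -> carrier F,
    (forall x, x \in free_vars phi -> dom w (g x)) -> holds M w g phi.

Definition logic_exp (W : Type) (R : W -> W -> Prop) (phi : formula) : Prop :=
  forall (F : pred_frame R) (M : model F) (w : W), true_at M w phi.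

Definition logic_const (W : Type) (R : W -> W -> Prop) (phi : formula) : Prop :=
  forall (F : pred_frame R) (M : model F) (w : W),
    constant_domain F -> true_at M w phi.

Definition satisfiable_for (L : formula -> Prop) (phi : formula) : Prop :=
  ~ L (Neg phi).

(* The total recursive functions: minimization is applied only to regular
   functions, i.e. when a zero exists for all values of the parameters.  The
   functions defined by primitive recursion and by minimization are given by
   their defining equations. *)
Inductive recursive : forall k : nat, (k.-tuple nat -> nat) -> Prop :=
| rec_zero k : recursive (fun _ : k.-tuple nat => 0)
| rec_succ : recursive (fun v : 1.-tuple nat => (thead v).+1)
| rec_proj k (i : 'I_k) : recursive (fun v : k.-tuple nat => tnth v i)
| rec_comp k m (f : m.-tuple nat -> nat) (g : 'I_m -> k.-tuple nat -> nat) :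
    recursive f -> (forall i, recursive (g i)) ->
    recursive (fun v : k.-tuple nat => f [tuple g i v | i < m])
| rec_prim k (f : k.-tuple nat -> nat) (g : k.+2.-tuple nat -> nat)
    (h : k.+1.-tuple nat -> nat) :
    recursive f -> recursive g ->
    (forall v : k.-tuple nat, h [tuple of 0 :: v] = f v) ->
    (forall (n : nat) (v : k.-tuple nat),
       h [tuple of n.+1 :: v] = g [tuple of n :: h [tuple of n :: v] :: v]) ->
    recursive h
| rec_min k (f : k.+1.-tuple nat -> nat) (h : k.-tuple nat -> nat) :
    recursive f ->
    (forall v : k.-tuple nat, f [tuple of h v :: v] = 0) ->
    (forall (v : k.-tuple nat) (n : nat), n < h v -> f [tuple of n :: v] <> 0) ->
    recursive h
| rec_ext k (f g : k.-tuple nat -> nat) : recursive f -> f =1 g -> recursive g.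

(* The Cantor pairing function: the binomial is (m + n)(m + n + 1)/2. *)
Definition cpair (m n : nat) : nat := 'C((m + n).+1, 2) + n.

Fixpoint code_seq (s : seq nat) : nat :=
  if s is x :: s' then (cpair x (code_seq s')).+1 else 0.

(* The arity of a letter is the length of its list of arguments. *)
Fixpoint code (phi : formula) : nat :=
  match phi with
  | Bot => cpair 0 0
  | Atom n i xs => cpair 1 (cpair i (code_seq xs))
  | Imp phi psi => cpair 2 (cpair (code phi) (code psi))
  | Box phi => cpair 3 (code phi)
  | All x phi => cpair 4 (cpair x (code phi))
  end.

Lemma cpair_inj m n m' n' : cpair m n = cpair m' n' -> m = m' /\ n = n'.
Proof.
have mono a b c d : a + b < c + d -> cpair a b < cpair c d.
  rewrite /cpair => lt.
  have le1 : 'C((a + b).+2, 2) <= 'C((c + d).+1, 2) by apply: leq_bin2l.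
  have e : 'C((a + b).+2, 2) = 'C((a + b).+1, 2) + (a + b).+1.
    by rewrite binS bin1.
  apply: (@leq_trans 'C((a + b).+2, 2)); last by apply: leq_trans le1 (leq_addr _ _).
  by rewrite e -addnS leq_add2l ltnS leq_addl.
move=> e; have es : m + n = m' + n'.
  case: (ltngtP (m + n) (m' + n')) => // /mono; by rewrite e ltnn.
have en : n = n' by move: e; rewrite /cpair es => /addnI.
by split=> //; move: es; rewrite en => /addIn.
Qed.

Lemma code_seq_inj : injective code_seq.
Proof.
elim=> [|x s IH] [|y t] //= [] /cpair_inj [-> /IH ->] //.
Qed.

Lemma code_inj : injective code.
Proof.
elim=> [|n i xs|f IHf g IHg|f IHf|x f IHf] [|n' i' xs'|f' g'|f'|x' f'] //=;
  case/cpair_inj=> // _.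
- case/cpair_inj=> <- /code_seq_inj e.
  have en : n = n' by rewrite -(size_tuple xs) e size_tuple.
  by case: _ / en xs' e => xs' /val_inj ->.
- by case/cpair_inj=> /IHf -> /IHg ->.
- by move/IHf ->.
- by case/cpair_inj=> <- /IHf ->.
Qed.

(* Arithmetical formulas of second-order arithmetic: number variables and set
   variables are both natural numbers, and only the former are quantified. *)
Inductive aterm : Type :=
| AVar (x : nat)
| AZero
| ASucc (t : aterm)
| AAdd (t u : aterm)
| AMul (t u : aterm).

Inductive aformula : Type :=
| AEq (t u : aterm)
| AMem (t : aterm) (X : nat)
| ABot
| AImp (a b : aformula)
| AAll (x : nat) (a : aformula).

Fixpoint aeval (e : nat -> nat) (t : aterm) : nat :=
  match t with
  | AVar x => e x
  | AZero => 0
  | ASucc t => (aeval e t).+1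
  | AAdd t u => aeval e t + aeval e u
  | AMul t u => aeval e t * aeval e u
  end.

Fixpoint aholds (S : nat -> nat -> Prop) (e : nat -> nat) (a : aformula) : Prop :=
  match a with
  | AEq t u => aeval e t = aeval e u
  | AMem t X => S X (aeval e t)
  | ABot => False
  | AImp a b => aholds S e a -> aholds S e b
  | AAll x a => forall n : nat,
      aholds S (fun y => if y == x then n else e y) a
  end.

(* A is defined in the standard model by the formula "exists X_1 ... X_m, a",
   where X_1, ..., X_m are the set variables of a: S interprets all the set
   variables at once.  All free number variables of a stand for the argument,
   as if they had been identified with one another. *)
Definition Sigma11 (A : nat -> Prop) : Prop :=
  exists a : aformula, forall n : nat,
    A n <-> exists S : nat -> nat -> Prop, aholds S (fun=> n) a.

(* With respect to recursive many-one reductions. *)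
Definition Sigma11_hard (B : formula -> Prop) : Prop :=
  forall A : nat -> Prop, Sigma11 A ->
    exists f : nat -> formula,
      recursive (fun v : 1.-tuple nat => code (f (thead v))) /\
      forall n : nat, A n <-> B (f n).

(* Main.v *)
(* Replace Box phi by "phi and Box phi": on (N, R) this is quantification over
   all later-or-equal points, whatever R is between < and <=, so R disappears.
   In a model, the truth values of the monadic letter on a domain element a form
   a word over N.  Counting the alternations still to come defines, for every j,
   an initial segment of N, so that an element with finitely many alternations is
   a decreasing list of numbers, and the order between the entries of two such
   lists is definable by a modal formula in two variables.  The length of the list
   is a static code for finitely much information.  Thus an element can stand for
   a tuple of numbers together with the truth values of finitely many relations
   on its entries.  With two variables one can say that all tuples over some
   infinite set of values exist and that the relations depend on the entries only;
   as a quantifier over one entry of a tuple is a quantifier over tuples,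
   first-order logic over (N, <) with existentially quantified relations is
   translated, which includes Sigma^1_1 arithmetic.  All quantifiers are evaluated
   at one point, hence it is irrelevant whether the domains expand. *)

From Stdlib Require Import Classical ClassicalEpsilon FunctionalExtensionality.
Require Import Defs.
From mathcomp Require Import all_boot.

Set Implicit Arguments.
Unset Strict Implicit.
Unset Printing Implicit Defensive.

(** * Recursive functions *)

Lemma rec_comp1 k (F : nat -> nat) (u : k.-tuple nat -> nat) :
  recursive (fun v : 1.-tuple nat => F (thead v)) -> recursive u ->
  recursive (fun v => F (u v)).
Proof.
move=> hF hu; apply: rec_ext (rec_comp hF (fun _ : 'I_1 => hu)) _ => v /=.
by rewrite /thead tnth_mktuple.
Qed.

Lemma rec_comp2 k (F : nat -> nat -> nat) (u w : k.-tuple nat -> nat) :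
  recursive (fun v : 2.-tuple nat => F (tnth v ord0) (tnth v ord_max)) ->
  recursive u -> recursive w -> recursive (fun v => F (u v) (w v)).
Proof.
move=> hF hu hw; pose g (i : 'I_2) := if i == ord0 then u else w.
have hg i : recursive (g i) by rewrite /g; case: ifP.
by apply: rec_ext (rec_comp hF hg) _ => v /=; rewrite !tnth_mktuple.
Qed.

Lemma rec_const k c : recursive (fun _ : k.-tuple nat => c).
Proof. by elim: c => [|c IH]; [exact: rec_zero | exact: rec_comp1 rec_succ IH]. Qed.

Lemma rec_thead : recursive (fun v : 1.-tuple nat => thead v).
Proof. exact: rec_proj. Qed.

Lemma rec_add k (u w : k.-tuple nat -> nat) :
  recursive u -> recursive w -> recursive (fun v => u v + w v).
Proof.
apply: rec_comp2.
apply: (rec_prim rec_thead (rec_comp1 rec_succ (rec_proj (inord 1 : 'I_3)))).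
- by move=> v; rewrite (tuple_eta v) /thead !(tnth_nth 0).
- by move=> n v; rewrite !(tnth_nth 0) /= inordK.
Qed.

Lemma rec_triangle k (u : k.-tuple nat -> nat) :
  recursive u -> recursive (fun v => 'C((u v).+1, 2)).
Proof.
apply: (@rec_comp1 _ (fun m => 'C(m.+1, 2))).
apply: (rec_prim (rec_const 0 0)
          (rec_add (rec_proj (inord 1 : 'I_2)) (rec_comp1 rec_succ (rec_proj (inord 0 : 'I_2))))).
- by move=> v; rewrite /thead (tnth_nth 0).
- by move=> n v; rewrite /thead !(tnth_nth 0) /= !inordK //= binS bin1.
Qed.

Lemma rec_cpair k (u w : k.-tuple nat -> nat) :
  recursive u -> recursive w -> recursive (fun v => cpair (u v) (w v)).
Proof. by move=> hu hw; apply: rec_add => //; apply/rec_triangle/rec_add. Qed.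

Lemma rec_iter (F : nat -> nat) (c : nat) :
  recursive (fun v : 1.-tuple nat => F (thead v)) ->
  recursive (fun v : 1.-tuple nat => iter (thead v) F c).
Proof.
move=> hF.
apply: (rec_prim (rec_const 0 c) (rec_comp1 hF (rec_proj (inord 1 : 'I_2)))).
- by move=> v; rewrite /thead (tnth_nth 0).
- by move=> n v; rewrite /thead !(tnth_nth 0) /= !inordK.
Qed.

(** * Arithmetic in a relational language *)

Definition upd (I : eqType) (A : Type) (e : I -> A) (z : I) (a : A) : I -> A :=
  fun y => if y == z then a else e y.
Arguments upd : simpl never.

(** Ternary letters suffice: the graphs of addition and multiplication are ternary, and sets are
    read off the diagonal. *)
Inductive rform : Type :=
| RLt (z z' : nat)
| RRel (r z1 z2 z3 : nat)
| RBot
| RImp (b c : rform)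
| RAll (z : nat) (b : rform).

Fixpoint rholds (rho : nat -> nat -> nat -> nat -> Prop) (e : nat -> nat)
    (b : rform) : Prop :=
  match b with
  | RLt z z' => e z < e z'
  | RRel r z1 z2 z3 => rho r (e z1) (e z2) (e z3)
  | RBot => False
  | RImp b c => rholds rho e b -> rholds rho e c
  | RAll z b => forall n, rholds rho (upd e z n) b
  end.

Fixpoint rwidth (b : rform) : nat :=
  match b with
  | RLt z z' => maxn z.+1 z'.+1
  | RRel _ z1 z2 z3 => maxn z1.+1 (maxn z2.+1 z3.+1)
  | RBot => 0
  | RImp b c => maxn (rwidth b) (rwidth c)
  | RAll z b => maxn z.+1 (rwidth b)
  end.

Fixpoint rletters (b : rform) : nat :=
  match b with
  | RRel r _ _ _ => r.+1
  | RImp b c => maxn (rletters b) (rletters c)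
  | RAll _ b => rletters b
  | _ => 0
  end.

Definition RNot b := RImp b RBot.
Definition RAnd b c := RNot (RImp b (RNot c)).
Definition RIff b c := RAnd (RImp b c) (RImp c b).
Definition REx z b := RNot (RAll z (RNot b)).
Definition REq z z' := RAnd (RNot (RLt z z')) (RNot (RLt z' z)).
(* The last argument of RZero and RSucc is a fresh variable. *)
Definition RZero z w := RAll w (RNot (RLt w z)).
Definition RSucc z z' w := RAnd (RLt z z') (RAll w (RNot (RAnd (RLt z w) (RLt w z')))).

Section RelationalSemantics.
Variable rho : nat -> nat -> nat -> nat -> Prop.
Implicit Types (e : nat -> nat) (b c : rform).

Lemma rholds_imp e b c : rholds rho e (RImp b c) = (rholds rho e b -> rholds rho e c).
Proof. by []. Qed.

Lemma rholds_all e z b : rholds rho e (RAll z b) = forall n, rholds rho (upd e z n) b.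
Proof. by []. Qed.

Lemma rholds_rel e r z1 z2 z3 :
  rholds rho e (RRel r z1 z2 z3) = rho r (e z1) (e z2) (e z3).
Proof. by []. Qed.

Lemma rholds_inst e z b n : rholds rho e (RAll z b) -> rholds rho (upd e z n) b.
Proof. exact. Qed.

Lemma rholds_and e b c : rholds rho e (RAnd b c) <-> rholds rho e b /\ rholds rho e c.
Proof. by move=> /=; tauto. Qed.

Lemma rholds_iff e b c : rholds rho e (RIff b c) <-> (rholds rho e b <-> rholds rho e c).
Proof. by rewrite rholds_and /=; tauto. Qed.

Lemma rholds_ex e z b : rholds rho e (REx z b) <-> exists n, rholds rho (upd e z n) b.
Proof.
split=> /= [h|[n hn] h]; last exact: h hn.
by apply: NNPP => h'; apply: h => n hn; apply: h'; exists n.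
Qed.

Lemma rholds_eq e z z' : rholds rho e (REq z z') <-> e z = e z'.
Proof.
rewrite rholds_and /=; split=> [[h1 h2]|->]; last by rewrite ltnn.
by case: (ltngtP (e z) (e z')).
Qed.

Lemma upd_same (I : eqType) A (e : I -> A) z a : upd e z a z = a.
Proof. by rewrite /upd eqxx. Qed.

Lemma upd_other (I : eqType) A (e : I -> A) z a y : y != z -> upd e z a y = e y.
Proof. by rewrite /upd => /negbTE ->. Qed.

Lemma rholds_zero e z w : z != w -> (rholds rho e (RZero z w) <-> e z = 0).
Proof.
move=> zw /=; split=> [h|z0 n]; last by rewrite upd_same upd_other // z0.
have := h 0; rewrite upd_same upd_other //.
by case: (e z) => // m; case.
Qed.

Lemma rholds_succ e z z' w : z != w -> z' != w ->
  (rholds rho e (RSucc z z' w) <-> e z' = (e z).+1).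
Proof.
move=> zw zw'; rewrite rholds_and /=; split=> [[lt h]|ez].
  have := h (e z).+1; rewrite upd_same !upd_other // ltnSn => {}h.
  by apply/eqP; rewrite eqn_leq lt andbT leqNgt; apply/negP=> lt'; apply: h => h; apply: h.
split=> [|n]; first by rewrite ez.
by rewrite upd_same !upd_other // ez => h; apply: h => h1; rewrite ltnS leqNgt h1.
Qed.

End RelationalSemantics.

#[local] Opaque RNot RAnd RIff REx REq RZero RSucc.

Fixpoint twidth (t : aterm) : nat :=
  match t with
  | AVar x => x.+1
  | AZero => 0
  | ASucc t => twidth t
  | AAdd t u | AMul t u => maxn (twidth t) (twidth u)
  end.

Fixpoint awidth (a : aformula) : nat :=
  match a with
  | AEq t u => maxn (twidth t) (twidth u)
  | AMem t _ => twidth t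
  | ABot => 0
  | AImp a b => maxn (awidth a) (awidth b)
  | AAll x a => maxn x.+1 (awidth a)
  end.

(* "z is the value of t"; the variables from d on are fresh.  The relation
   letters 0 and 1 stand for the graphs of addition and multiplication. *)
Fixpoint rterm (t : aterm) (z d : nat) : rform :=
  match t with
  | AVar x => REq z x
  | AZero => RZero z d
  | ASucc t => REx d (RAnd (rterm t d d.+1) (RSucc d z d.+1))
  | AAdd t u => REx d (REx d.+1
      (RAnd (RAnd (rterm t d d.+2) (rterm u d.+1 d.+2)) (RRel 0 d d.+1 z)))
  | AMul t u => REx d (REx d.+1
      (RAnd (RAnd (rterm t d d.+2) (rterm u d.+1 d.+2)) (RRel 1 d d.+1 z)))
  end.

(* The relation letter X + 2, restricted to the diagonal, stands for the set
   variable X. *)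
Fixpoint rarith (d : nat) (a : aformula) : rform :=
  match a with
  | AEq t u => REx d (RAnd (rterm t d d.+1) (rterm u d d.+1))
  | AMem t X => REx d (RAnd (rterm t d d.+1) (RRel X.+2 d d d))
  | ABot => RBot
  | AImp a b => RImp (rarith d a) (rarith d b)
  | AAll x a => RAll x (rarith d a)
  end.

(** The recursion equations in the second argument; they have a unique solution by induction.
    Variable 5 is the auxiliary one of [RZero] and [RSucc]. *)
Definition add_axioms : rform :=
  RAnd
    (RAll 0 (RAll 1 (RAll 3 (RImp (RZero 1 5) (RIff (RRel 0 0 1 3) (REq 3 0))))))
    (RAll 0 (RAll 1 (RAll 2 (RAll 3 (RImp (RSucc 1 2 5)
      (RIff (RRel 0 0 2 3) (REx 4 (RAnd (RRel 0 0 1 4) (RSucc 4 3 5))))))))).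

Definition mul_axioms : rform :=
  RAnd
    (RAll 0 (RAll 1 (RAll 3 (RImp (RZero 1 5) (RIff (RRel 1 0 1 3) (RZero 3 5))))))
    (RAll 0 (RAll 1 (RAll 2 (RAll 3 (RImp (RSucc 1 2 5)
      (RIff (RRel 1 0 2 3) (REx 4 (RAnd (RRel 1 0 1 4) (RRel 0 4 0 3))))))))).

Section Arithmetic.
Variable rho : nat -> nat -> nat -> nat -> Prop.

Lemma rholds_add e :
  rholds rho e add_axioms <-> forall l m n, rho 0 l m n <-> n = l + m.
Proof.
rewrite rholds_and; split=> [[h0 hS]|h].
  move=> l m; elim: m => [|m IH] n.
    have /(rholds_inst l)/(rholds_inst 0)/(rholds_inst n) := h0.
    rewrite rholds_imp rholds_zero // rholds_iff rholds_eq /=.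
    by rewrite /upd /= addn0 => ->.
  have /(rholds_inst l)/(rholds_inst m)/(rholds_inst m.+1)/(rholds_inst n) := hS.
  rewrite rholds_imp rholds_succ // rholds_iff rholds_ex /=.
  rewrite /upd /= => -> //; split=> [[w]|->].
    by rewrite rholds_and rholds_succ //= /upd /= => -[/IH -> ->]; rewrite addnS.
  by exists (l + m); rewrite rholds_and rholds_succ //= /upd /= IH addnS.
split=> /= l m n.
  by rewrite rholds_zero // rholds_iff rholds_eq /= /upd /= => ->; rewrite h addn0; split.
move=> k; rewrite rholds_succ // rholds_iff rholds_ex /= /upd /= => ->.
rewrite h addnS; split=> [->|[w]].
  by exists (l + m); rewrite rholds_and rholds_succ //= /upd /= h.
by rewrite rholds_and rholds_succ //= /upd /= h => -[-> ->].
Qed.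

Lemma rholds_mul e : (forall l m n, rho 0 l m n <-> n = l + m) ->
  (rholds rho e mul_axioms <-> forall l m n, rho 1 l m n <-> n = l * m).
Proof.
move=> hadd; rewrite rholds_and; split=> [[h0 hS]|h].
  move=> l m; elim: m => [|m IH] n.
    have /(rholds_inst l)/(rholds_inst 0)/(rholds_inst n) := h0.
    rewrite rholds_imp rholds_zero // rholds_iff rholds_zero //=.
    by rewrite /upd /= muln0 => ->.
  have /(rholds_inst l)/(rholds_inst m)/(rholds_inst m.+1)/(rholds_inst n) := hS.
  rewrite rholds_imp rholds_succ // rholds_iff rholds_ex /=.
  rewrite /upd /= => -> //; split=> [[w]|->].
    by rewrite rholds_and /= /upd /= hadd mulnSr => -[/IH -> ->].
  by exists (l * m); rewrite rholds_and /= /upd /= IH hadd mulnSr.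
split=> /= l m n.
  by rewrite rholds_zero // rholds_iff rholds_zero //= /upd /= => ->; rewrite h muln0.
move=> k; rewrite rholds_succ // rholds_iff rholds_ex /= /upd /= => ->.
rewrite h mulnSr; split=> [->|[w]].
  by exists (l * m); rewrite rholds_and /= /upd /= h hadd.
by rewrite rholds_and /= /upd /= h hadd => -[-> ->].
Qed.

Hypothesis rho_add : forall l m n, rho 0 l m n <-> n = l + m.
Hypothesis rho_mul : forall l m n, rho 1 l m n <-> n = l * m.

Lemma agree_upd_fresh c d (e e' : nat -> nat) n : c <= d ->
  (forall y, y < c -> e y = e' y) -> forall y, y < c -> upd e d n y = e' y.
Proof.
move=> cd ee' y yc; rewrite upd_other ?ee' //.
by apply: contraTneq yc => ->; rewrite -leqNgt.
Qed.

(** The variables of [t] lie below [c] and the auxiliary ones start at [d], with [c <= d], so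
    intermediate results never overwrite the values shared with [e']. *)
Lemma rholds_term c t z d (e e' : nat -> nat) :
  twidth t <= c -> c <= d -> z < d -> (forall y, y < c -> e y = e' y) ->
  rholds rho e (rterm t z d) <-> e z = aeval e' t.
Proof.
(* Addition and multiplication at once: [r] is the letter for the graph of [op]. *)
have binop t1 t2 (r : nat) (op : nat -> nat -> nat) :
    (forall l m n, rho r l m n <-> n = op l m) ->
    (forall z d (e : nat -> nat), twidth t1 <= c -> c <= d -> z < d ->
      (forall y, y < c -> e y = e' y) ->
      rholds rho e (rterm t1 z d) <-> e z = aeval e' t1) ->
    (forall z d (e : nat -> nat), twidth t2 <= c -> c <= d -> z < d ->
      (forall y, y < c -> e y = e' y) ->
      rholds rho e (rterm t2 z d) <-> e z = aeval e' t2) ->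
    forall z d (e : nat -> nat), maxn (twidth t1) (twidth t2) <= c -> c <= d -> z < d ->
      (forall y, y < c -> e y = e' y) ->
      rholds rho e (REx d (REx d.+1 (RAnd (RAnd (rterm t1 d d.+2) (rterm t2 d.+1 d.+2))
        (RRel r d d.+1 z)))) <-> e z = op (aeval e' t1) (aeval e' t2).
  move=> hr IH1 IH2 {}z {}d {}e; rewrite geq_max => /andP[w1 w2] cd zd ee'.
  have nz : z != d by rewrite neq_ltn zd.
  have nz1 : z != d.+1 by rewrite neq_ltn ltnS ltnW.
  have nd : d != d.+1 by rewrite neq_ltn ltnSn.
  have body l m :
      rholds rho (upd (upd e d l) d.+1 m) (RAnd (RAnd (rterm t1 d d.+2) (rterm t2 d.+1 d.+2))
        (RRel r d d.+1 z)) <-> l = aeval e' t1 /\ m = aeval e' t2 /\ e z = op l m.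
    have agree : forall y, y < c -> upd (upd e d l) d.+1 m y = e' y.
      by apply: agree_upd_fresh (leqW cd) _; apply: agree_upd_fresh.
    have cd2 : c <= d.+2 by rewrite leqW // leqW.
    rewrite !rholds_and (IH1 d _ _ w1 cd2 _ agree) // (IH2 d.+1 _ _ w2 cd2 _ agree) //.
    rewrite rholds_rel hr !upd_same.
    rewrite !(upd_other _ _ nd, upd_other _ _ nz, upd_other _ _ nz1) upd_same.
    by tauto.
  rewrite rholds_ex; split=> [[l]|ez].
    by rewrite rholds_ex => -[m /body [-> [->]]].
  exists (aeval e' t1); rewrite rholds_ex; exists (aeval e' t2).
  exact/body.
elim: t z d e => [x||t IH|t1 IH1 t2 IH2|t1 IH1 t2 IH2] z d e /= w cd zd ee'.
- by rewrite rholds_eq -ee'.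
- by rewrite rholds_zero // neq_ltn zd.
- have nz : z != d by rewrite neq_ltn zd.
  have nz1 : z != d.+1 by rewrite neq_ltn ltnS ltnW.
  have body l : rholds rho (upd e d l) (RAnd (rterm t d d.+1) (RSucc d z d.+1)) <->
      l = aeval e' t /\ e z = l.+1.
    have nd : d != d.+1 by rewrite neq_ltn ltnSn.
    have agree := agree_upd_fresh l cd ee'.
    rewrite rholds_and (IH d _ _ w (leqW cd) (ltnSn d) agree) rholds_succ //.
    by rewrite !upd_same (upd_other _ _ nz); split=> -[->].
  rewrite rholds_ex; split=> [[l /body [-> ->]]|ez] //.
  by exists (aeval e' t); apply/body.
- exact: binop rho_add _ _ _ _ _ _ _ _ _.
- exact: binop rho_mul _ _ _ _ _ _ _ _ _.
Qed.

(** The quantifiers of [a] bind variables below [c] only, so all atomic formulas can share the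
    auxiliary variables from [c] on. *)
Lemma rholds_arith c a (e e' : nat -> nat) :
  awidth a <= c -> (forall y, y < c -> e y = e' y) ->
  rholds rho e (rarith c a) <-> aholds (fun X n => rho X.+2 n n n) e' a.
Proof.
elim: a e e' => [t u|t X||a IHa b IHb|x a IH] e e' /=.
- rewrite geq_max => /andP[wt wu] ee'; rewrite rholds_ex.
  have body n : rholds rho (upd e c n) (RAnd (rterm t c c.+1) (rterm u c c.+1)) <->
      n = aeval e' t /\ n = aeval e' u.
    have agree := @agree_upd_fresh c c e e' n (leqnn c) ee'.
    rewrite rholds_and (rholds_term wt (leqnSn c) (ltnSn c) agree).
    by rewrite (rholds_term wu (leqnSn c) (ltnSn c) agree) upd_same.
  by split=> [[n /body [-> ]]|E] //; exists (aeval e' t); apply/body.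
- move=> wt ee'; rewrite rholds_ex.
  have body n : rholds rho (upd e c n) (RAnd (rterm t c c.+1) (RRel X.+2 c c c)) <->
      n = aeval e' t /\ rho X.+2 n n n.
    have agree := @agree_upd_fresh c c e e' n (leqnn c) ee'.
    by rewrite rholds_and (rholds_term wt (leqnSn c) (ltnSn c) agree) /= upd_same.
  by split=> [[n /body [-> ]]|E] //; exists (aeval e' t); apply/body.
- by [].
- by rewrite geq_max => /andP[wa wb] ee'; rewrite (IHa _ _ wa ee') (IHb _ _ wb ee').
- rewrite geq_max => /andP[wx wa] ee'.
  have step n : rholds rho (upd e x n) (rarith c a) <->
      aholds (fun X n => rho X.+2 n n n) (upd e' x n) a.
    by apply: IH => // y yc; rewrite /upd; case: ifP => // _; apply: ee'.
  by split=> h n; apply/step/h.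
Qed.

End Arithmetic.

(** * Reducing Sigma^1_1 definitions to relational formulas with numerals *)

Fixpoint identify (c j : nat) (b : rform) : rform :=
  if j is j'.+1 then RAll j' (RImp (REq j' c) (identify c j' b)) else b.

(** [Sigma11] gives all free number variables the same value; forcing the variables below [c] to
    equal [c] leaves a property of the value of [c] alone. *)
Lemma rholds_identify rho c b (Q : nat -> Prop) :
  (forall e n, (forall y, y < c -> e y = n) -> rholds rho e b <-> Q n) ->
  forall e, rholds rho e (identify c c b) <-> Q (e c).
Proof.
(* Generalised to a partial identification: the variables from [j] on already agree with [c]. *)
move=> hb; suff main j e : j <= c -> (forall y, j <= y -> y < c -> e y = e c) ->
    rholds rho e (identify c j b) <-> Q (e c).
  by move=> e; apply: main => // y cy; rewrite ltnNge cy.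
elim: j e => [|j IH] e jc agree /=; first by apply: hb => y; apply: agree.
have ncj : c != j by rewrite neq_ltn jc orbT.
have step n : n = e c -> rholds rho (upd e j n) (identify c j b) <-> Q (e c).
  move=> ->; rewrite -[in Q _](@upd_other _ _ e j (e c) c ncj).
  apply: IH => [|y jy yc]; first exact: ltnW.
  rewrite (upd_other _ _ ncj) /upd; case: eqP => // /eqP yj.
  by rewrite agree // ltn_neqAle eq_sym yj.
split=> [h|q n]; last by rewrite rholds_eq upd_same upd_other // => /step ->.
by apply/(step (e c)) => //; apply: h; rewrite rholds_eq upd_same upd_other.
Qed.

(** Moves [c] to its successor: [c.+1] carries the new value while [c] is bound again. Reusing the
    same three variables keeps the width of all iterates bounded. *)
Definition advance (c : nat) (b : rform) : rform :=
  RAll c.+1 (RImp (RSucc c c.+1 c.+2) (RAll c (RImp (REq c c.+1) b))).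

Lemma rholds_advance rho c b (Q : nat -> Prop) m :
  (forall e, rholds rho e b <-> Q (e c)) ->
  forall e, rholds rho e (iter m (advance c) b) <-> Q (m + e c).
Proof.
move=> hb; elim: m => [|m IH] e; first by rewrite hb.
have nc : c != c.+1 by rewrite neq_ltn ltnSn.
have nc' : c.+1 != c by rewrite eq_sym.
rewrite iterS /advance /=; split=> [h|q n].
  have := h (e c).+1; rewrite rholds_succ; last 2 first.
  - by rewrite neq_ltn ltnS leqnSn.
  - by rewrite neq_ltn ltnSn.
  rewrite upd_same (upd_other _ _ nc) => /(_ erefl (e c).+1).
  by rewrite rholds_eq upd_same (upd_other _ _ nc') upd_same IH upd_same addnS => /(_ erefl).
rewrite rholds_succ; last 2 first.
- by rewrite neq_ltn ltnS leqnSn.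
- by rewrite neq_ltn ltnSn.
rewrite upd_same (upd_other _ _ nc) => -> k.
by rewrite rholds_eq upd_same (upd_other _ _ nc') upd_same IH upd_same => ->; rewrite addnS.
Qed.

Section Reduction.
Variable a : aformula.
Let c := awidth a.

(* The numeral n is reached by n moves of the variable c, so that the code of
   the translated formula is an iterate of one recursive function. *)
Definition counted (n : nat) : rform := iter n (advance c) (identify c c (rarith c a)).

Definition sigma_form (n : nat) : rform :=
  RAnd (RAnd add_axioms mul_axioms) (RAll c (RImp (RZero c c.+1) (counted n))).

Lemma rholds_counted rho n e :
  (forall l m n, rho 0 l m n <-> n = l + m) ->
  (forall l m n, rho 1 l m n <-> n = l * m) ->
  rholds rho e (RAll c (RImp (RZero c c.+1) (counted n))) <->
  aholds (fun X n => rho X.+2 n n n) (fun=> n) a.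
Proof.
move=> hadd hmul.
pose Q k := aholds (fun X n => rho X.+2 n n n) (fun=> k) a.
have hid : forall e', rholds rho e' (identify c c (rarith c a)) <-> Q (e' c).
  apply: rholds_identify => e' m he'.
  exact: (@rholds_arith rho hadd hmul c a e' (fun=> m) (leqnn c) he').
have body k : rholds rho (upd e c k) (RImp (RZero c c.+1) (counted n)) <->
    (k = 0 -> Q (n + k)).
  rewrite rholds_imp rholds_zero ?neq_ltn ?ltnSn // /counted (rholds_advance n hid).
  by rewrite upd_same.
rewrite rholds_all; split=> [h|h k]; first by have /body/(_ erefl) := h 0; rewrite addn0.
by apply/body => ->; rewrite addn0.
Qed.

Lemma sigma_form_sound n (S : nat -> nat -> Prop) : aholds S (fun=> n) a ->
  exists rho, forall e, rholds rho e (sigma_form n).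
Proof.
move=> h; pose rho r l m k := match r with
  | 0 => k = l + m | 1 => k = l * m | X.+2 => S X k end.
exists rho => e.
have hadd : forall l m k, rho 0 l m k <-> k = l + m by [].
have hmul : forall l m k, rho 1 l m k <-> k = l * m by [].
apply/rholds_and; split; last exact/(rholds_counted n e hadd hmul).
by apply/rholds_and; split; [apply/rholds_add | apply/(rholds_mul e hadd)].
Qed.

Lemma sigma_form_complete n rho e : rholds rho e (sigma_form n) ->
  exists S, aholds S (fun=> n) a.
Proof.
move=> /rholds_and[/rholds_and[/rholds_add hadd]].
move=> /(rholds_mul _ hadd) hmul /(rholds_counted _ _ hadd hmul) h.
by exists (fun X n => rho X.+2 n n n).
Qed.

#[local] Transparent RNot RAnd RIff REx REq RZero RSucc.

(** The encoding below depends on a width and a number of letters; bounds uniform in [n] let one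
    encoding serve all inputs. *)
Lemma sigma_form_bounded : exists N q, forall n,
  rwidth (sigma_form n) <= N /\ rletters (sigma_form n) <= q.
Proof.
pose A := RAnd add_axioms mul_axioms.
pose N := maxn (rwidth A) (maxn (rwidth (counted 0)) c.+3).
pose q := maxn (rletters A) (rletters (counted 0)).
have w3 : c.+3 <= N by rewrite /N !leq_max leqnn !orbT.
have w2 : c.+2 <= N := ltnW w3.
have w1 : c.+1 <= N := ltnW w2.
have w n : rwidth (counted n) <= N.
  rewrite /counted; elim: n => [|n]; first by rewrite /N !leq_max leqnn !orbT.
  by rewrite iterS; move: (iter n _ _) => b /= hb; rewrite !geq_max w1 w2 w3 hb.
have l n : rletters (counted n) <= q.
  rewrite /counted; elim: n => [|n]; first by rewrite /q !leq_max leqnn !orbT.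
  by rewrite iterS; move: (iter n _ _) => b /= hb; rewrite !geq_max hb.
have wA : rwidth A <= N by rewrite /N leq_maxl.
have lA : rletters A <= q by rewrite /q leq_maxl.
exists N, q => n; move: (w n) (l n); rewrite /sigma_form -/A.
clearbody N q A; move: (counted n) => b hw hl /=.
by rewrite !geq_max w1 w2 wA lA hw hl.
Qed.

End Reduction.

(** * Two-variable modal formulas *)

(* The two variables are named by booleans; MG f stands for "f and Box f". *)
Inductive mform : Type :=
| MBot
| MP (v : bool)
| MImp (f h : mform)
| MG (f : mform)
| MAll (v : bool) (f : mform).

Definition MNot f := MImp f MBot.
Definition MAnd f h := MNot (MImp f (MNot h)).
Definition MOr f h := MImp (MNot f) h.
Definition MIff f h := MAnd (MImp f h) (MImp h f).
Definition MEx v f := MNot (MAll v (MNot f)).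
Definition MF f := MNot (MG (MNot f)).
Definition MBigOr T (s : seq T) (F : T -> mform) := foldr (fun t f => MOr (F t) f) MBot s.
Definition MBigAnd T (s : seq T) (F : T -> mform) :=
  foldr (fun t f => MAnd (F t) f) (MNot MBot) s.

(* If the letter is finally false on v: its truth value on v changes at least
   j + 1 more times. *)
Fixpoint alternations (j : nat) (v : bool) : mform :=
  if j is j'.+1
  then MF (MAnd (if odd j then MNot (MP v) else MP v) (alternations j' v))
  else MF (MP v).

Section ModalSemantics.
Variables (D : Type) (dm P : nat -> D -> Prop).
Implicit Types (w : nat) (g : bool -> D) (f h : mform).

Fixpoint msat w g f : Prop :=
  match f with
  | MBot => False
  | MP v => P w (g v)
  | MImp f h => msat w g f -> msat w g h
  | MG f => forall u, w <= u -> msat u g f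
  | MAll v f => forall a, dm w a -> msat w (upd g v a) f
  end.

Lemma msat_imp w g f h : msat w g (MImp f h) = (msat w g f -> msat w g h).
Proof. by []. Qed.

Lemma msat_not w g f : msat w g (MNot f) <-> ~ msat w g f.
Proof. by []. Qed.

Lemma msat_and w g f h : msat w g (MAnd f h) <-> msat w g f /\ msat w g h.
Proof. by move=> /=; tauto. Qed.

Lemma msat_or w g f h : msat w g (MOr f h) <-> msat w g f \/ msat w g h.
Proof. by move=> /=; tauto. Qed.

Lemma msat_iff w g f h : msat w g (MIff f h) <-> (msat w g f <-> msat w g h).
Proof. by rewrite msat_and /=; tauto. Qed.

Lemma msat_all w g v f :
  msat w g (MAll v f) = forall a, dm w a -> msat w (upd g v a) f.
Proof. by []. Qed.

Lemma msat_inst w g v f a : msat w g (MAll v f) -> dm w a -> msat w (upd g v a) f.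
Proof. exact. Qed.

Lemma msat_ex w g v f :
  msat w g (MEx v f) <-> exists a, dm w a /\ msat w (upd g v a) f.
Proof.
split=> /= [h|[a [da ha]] h]; last exact: h a da ha.
by apply: NNPP => h'; apply: h => a da ha; apply: h'; exists a.
Qed.

Lemma msat_F w g f : msat w g (MF f) <-> exists u, w <= u /\ msat u g f.
Proof.
split=> /= [h|[u [wu hu]] h]; last exact: h u wu hu.
by apply: NNPP => h'; apply: h => u wu hu; apply: h'; exists u.
Qed.

Lemma msat_bigor (T : eqType) w g (s : seq T) F :
  msat w g (MBigOr s F) <-> exists2 t, t \in s & msat w g (F t).
Proof.
elim: s => [|t s IH]; first by split=> [|[t]].
rewrite [MBigOr _ _]/= msat_or IH; split=> [[h|[t' ts h]]|[t']].
- by exists t; rewrite ?mem_head.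
- by exists t'; rewrite // inE ts orbT.
- by rewrite inE => /orP[/eqP->|ts h]; [left | right; exists t'].
Qed.

Lemma msat_bigand (T : eqType) w g (s : seq T) F :
  msat w g (MBigAnd s F) <-> forall t, t \in s -> msat w g (F t).
Proof.
elim: s => [|t s IH]; first by split=> // _ [].
rewrite [MBigAnd _ _]/= msat_and IH; split=> [[h hs] t'|h].
  by rewrite inE => /orP[/eqP->|/hs].
by split=> [|t' ts]; apply: h; rewrite inE ?eqxx ?ts ?orbT.
Qed.

Fixpoint alternates (j w : nat) (a : D) : Prop :=
  if j is j'.+1
  then exists u, w <= u /\ (if odd j then ~ P u a else P u a) /\ alternates j' u a
  else exists u, w <= u /\ P u a.

Lemma msat_alternations w g j v :
  msat w g (alternations j v) <-> alternates j w (g v).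
Proof.
elim: j w => [|j IH] w; rewrite [alternations _ _]/= msat_F //.
by split=> -[u [wu h]]; exists u; split=> //; move: h; rewrite msat_and IH /=; case: odd.
Qed.

Lemma alternates_down j w u a : w <= u -> alternates j u a -> alternates j w a.
Proof.
by case: j => [|j] wu [t [ut h]]; exists t; rewrite (leq_trans wu ut).
Qed.

Lemma alternates_le i j w a : i <= j -> alternates j w a -> alternates i w a.
Proof.
elim: j w => [|j IH] w; first by rewrite leqn0 => /eqP->.
rewrite leq_eqVlt => /predU1P[-> //|ij] [u [wu [_ h]]].
by apply: alternates_down wu _; apply: IH.
Qed.

(** By [alternates_down] these points are closed downwards, so once one point is missing they form a
    finite initial segment. Its length is the number that place [j] of the element denotes. *)
Lemma alternates_threshold j w a : ~ alternates j w a ->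
  exists n, forall u, alternates j u a <-> u < n.
Proof.
elim: w => [|w IH] h.
  by exists 0 => u; split=> // /(alternates_down (leq0n u)).
case: (classic (alternates j w a)) => [h'|/IH //].
exists w.+1 => u; split=> [hu|]; last by rewrite ltnS => uw; apply: alternates_down uw h'.
by rewrite ltnNge; apply/negP=> wu; apply: h; apply: alternates_down wu hu.
Qed.

End ModalSemantics.

(** * Embedding into first-order modal formulas *)

Section Embedding.
Variables (x y i : nat).
Hypothesis neq_xy : x <> y.

Definition variable (v : bool) : nat := if v then x else y.

Fixpoint embed (f : mform) : formula :=
  match f with
  | MBot => Bot
  | MP v => Atom i [tuple variable v]
  | MImp f h => Imp (embed f) (embed h)
  | MG f => Neg (Imp (embed f) (Neg (Box (embed f))))
  | MAll v f => All (variable v) (embed f)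
  end.

Lemma embed_in_language j f : in_language x y i j (embed f).
Proof.
have mem_variable v : variable v \in [:: x; y].
  by rewrite /variable !inE; case: v; rewrite eqxx ?orbT.
elim: f => [|v|f [vf lf] h [vh lh]|f [vf lf]|v f [vf lf]]; split=> z //=.
- by rewrite inE => /eqP->.
- by rewrite inE => /eqP->; rewrite !inE eqxx.
- by rewrite mem_cat => /orP[/vf|/vh].
- by rewrite mem_cat => /orP[/lf|/lh].
- by rewrite !cats0 mem_cat => /orP[] /vf.
- by rewrite !cats0 mem_cat => /orP[] /lf.
- by rewrite inE => /predU1P[->|/vf].
- exact: lf.
Qed.

Lemma variable_inj : injective variable.
Proof. by move=> [] [] //= e; case: neq_xy. Qed.

Variable R : nat -> nat -> Prop.
Hypothesis lt_sub_R : forall m n : nat, m < n -> R m n.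
Hypothesis R_sub_le : forall m n : nat, R m n -> m <= n.

(** For every [R] between the two orders, a point together with its [R]-successors is exactly the
    set of later-or-equal points. Since [x] and [y] differ, updating one variable leaves the other
    alone. *)
Lemma holds_embed (F : pred_frame R) (M : model F) w g f :
  holds M w g (embed f) <->
  msat (@dom _ _ F) (fun w a => interp M w i [tuple a]) w (fun v => g (variable v)) f.
Proof.
elim: f w g => [|v|f IHf h IHh|f IH|v f IH] w g //=.
- by have -> : map_tuple g [tuple variable v] = [tuple g (variable v)] by apply: val_inj.
- by rewrite IHf IHh.
- split=> [h u|h].
    rewrite leq_eqVlt => /predU1P[<-|/lt_sub_R wu]; rewrite -IH; apply: NNPP => h'.
      by apply: h => /h'.
    by apply: h => _ /(_ u wu).
  by apply=> [|u /R_sub_le wu]; apply/IH/h.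
- split=> [h a da|h g' gg' dg'].
    have := h (upd g (variable v) a); rewrite IH upd_same => h1.
    have -> : upd (fun v' => g (variable v')) v a =
              (fun v' => upd g (variable v) a (variable v')).
      by apply: functional_extensionality => v'; rewrite /upd (inj_eq variable_inj).
    by apply: h1 => // z /eqP zv; rewrite upd_other.
  rewrite IH; have := h _ dg'; congr (msat _ _ _ _ _).
  apply: functional_extensionality => v'; rewrite /upd; case: eqP => [-> //|nv].
  by rewrite gg' // => /variable_inj.
Qed.

End Embedding.

(** * Encoding tuples in domain elements *)

Section Encoding.
Variables N q : nat.

(* The static part of an element: the place of each coordinate in its list of
   alternation times, and the relations between its coordinates.  It is read off
   the number of alternations. *)
Definition profile : finType :=
  ({ffun 'I_N.+1 -> 'I_N.+1} * {ffun 'I_q.+1 * 'I_N.+1 * 'I_N.+1 * 'I_N.+1 -> bool})%type.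

Definition slot (s : profile) (z : nat) : nat := s.1 (inord z).
Definition atom (s : profile) (r z1 z2 z3 : nat) : bool :=
  s.2 (inord r, inord z1, inord z2, inord z3).
(** The rank makes the height injective in the profile; the summand [N.+1] puts every slot below
    it. *)
Definition height (s : profile) : nat := N.+1 + enum_rank s.

Lemma slot_height s z : slot s z < height s.
Proof. exact: leq_trans (ltn_ord _) (leq_addr _ _). Qed.

Definition has_profile s v : mform :=
  MAnd (alternations (height s) v) (MNot (alternations (height s).+1 v)).

(** For fixed profiles both slots are known, and the entries are compared by a point that the first
    initial segment has left and the second still contains. *)
Definition mlt z z' u v : mform :=
  MBigOr (enum profile) (fun s => MBigOr (enum profile) (fun s' =>
    MAnd (MAnd (has_profile s u) (has_profile s' v))
         (MF (MAnd (MNot (alternations (slot s z) u)) (alternations (slot s' z') v))))).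

Definition meq z z' u v : mform := MAnd (MNot (mlt z z' u v)) (MNot (mlt z' z v u)).

Definition matom r z1 z2 z3 v : mform :=
  MBigOr [seq s <- enum profile | atom s r z1 z2 z3] (fun s => has_profile s v).

(** The list starts at 1: the scratch coordinate may change freely. *)
Definition mvariant z u v : mform :=
  MBigAnd [seq z' <- iota 1 N | z' != z] (fun z' => meq z' z' u v).

(* Coordinate 0 is scratch space; coordinate z + 1 is the variable z. *)
Fixpoint translate (v : bool) (b : rform) : mform :=
  match b with
  | RLt z z' => mlt z.+1 z'.+1 v v
  | RRel r z1 z2 z3 => matom r z1.+1 z2.+1 z3.+1 v
  | RBot => MBot
  | RImp b c => MImp (translate v b) (translate v c)
  | RAll z b => MAll (~~ v) (MImp (mvariant z.+1 v (~~ v)) (translate (~~ v) b))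
  end.

(** Bounding the alternations is not enough: if the letter were finally true, [alternations 0] would
    hold everywhere and denote no number. *)
Definition well_formed : mform :=
  MAll true (MAnd (MBigOr (enum profile) (fun s => has_profile s true))
                  (MNot (MG (alternations 0 true)))).

(** The bound concerns all coordinates of all elements, so that the coordinates share one least
    value. *)
Definition has_minimum z : mform :=
  MAll true (MEx false (MAnd (mvariant z true false)
    (MAll true (MBigAnd (iota 0 N.+1) (fun z' => MNot (mlt z' z true false)))))).

(* The scratch coordinate of the new element remembers the old value, so that
   two variables suffice to say that no value lies strictly in between. *)
Definition has_successor z : mform :=
  MAll true (MEx false (MAnd
    (MAnd (mvariant z true false) (MAnd (meq z 0 true false) (mlt 0 z false false)))
    (MAll true (MBigAnd (iota 0 N.+1) (fun z' =>
       MNot (MAnd (mlt 0 z' false true) (mlt z' z true false))))))).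

(** Coordinates 1, 2, 3 serve as reference: agreement with them makes a relation depend on the
    values only, not on the element or on the places. *)
Definition consistent r z1 z2 z3 : mform :=
  MAll true (MAll false (MImp
    (MAnd (meq z1 1 true false) (MAnd (meq z2 2 true false) (meq z3 3 true false)))
    (MIff (matom r z1 z2 z3 true) (matom r 1 2 3 false)))).

Definition theory : mform :=
  MAnd (MBigAnd (iota 1 N) (fun z => MAnd (has_minimum z) (has_successor z)))
    (MBigAnd (iota 0 q.+1) (fun r => MBigAnd (iota 1 N) (fun z1 =>
       MBigAnd (iota 1 N) (fun z2 => MBigAnd (iota 1 N) (fun z3 => consistent r z1 z2 z3))))).

Definition mtop (b : rform) : mform :=
  MEx true (MAnd (MAnd well_formed theory) (translate true b)).

(** * Meaning of the encoding formulas, given the values and the profile of each element *)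

Section Semantics.
Variables (D : Type) (dm P : nat -> D -> Prop) (w0 : nat).
Variables (val : D -> nat -> nat) (pf : D -> profile).
Implicit Types (g : bool -> D) (u v : bool) (a : D).

Hypothesis profile_spec : forall a s, dm w0 a ->
  (alternates P (height s) w0 a /\ ~ alternates P (height s).+1 w0 a) <-> s = pf a.
Hypothesis val_spec : forall a z w, dm w0 a -> z <= N ->
  alternates P (slot (pf a) z) w a <-> w < val a z.

Local Notation sat := (msat dm P w0).

Lemma sat_profile g s v : dm w0 (g v) -> sat g (has_profile s v) <-> s = pf (g v).
Proof. by move=> dv; rewrite -profile_spec // msat_and msat_not !msat_alternations. Qed.

(** At [w0] the profile counts more alternations than any slot, so every value lies beyond the
    evaluation point. *)
Lemma val_ge a z : dm w0 a -> z <= N -> w0 < val a z.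
Proof.
move=> da zN; apply/(val_spec _ da zN).
have [h _] := iffRL (profile_spec (pf a) da) erefl.
exact: alternates_le (ltnW (slot_height _ _)) h.
Qed.

Lemma sat_lt g z z' u v : dm w0 (g u) -> dm w0 (g v) -> z <= N -> z' <= N ->
  sat g (mlt z z' u v) <-> val (g u) z < val (g v) z'.
Proof.
move=> du dv zN zN'; rewrite msat_bigor.
split=> [[s _ /msat_bigor[s' _]]|lt].
  move=> /msat_and[/msat_and[/(sat_profile _ du) -> /(sat_profile _ dv) ->]].
  move=> /msat_F[w [_]]; rewrite msat_and msat_not !msat_alternations !val_spec // => -[/negP].
  by rewrite -leqNgt; apply: leq_ltn_trans.
exists (pf (g u)); rewrite ?mem_enum //; apply/msat_bigor.
exists (pf (g v)); rewrite ?mem_enum //; apply/msat_and.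
split; first by apply/msat_and; split; apply/sat_profile.
(* The first point outside the initial segment of the smaller value; [val_ge] makes it accessible
   from [w0]. *)
apply/msat_F; exists (val (g u) z); rewrite ltnW ?val_ge //; split=> //.
by rewrite msat_and msat_not !msat_alternations !val_spec // ltnn.
Qed.

Lemma sat_eq g z z' u v : dm w0 (g u) -> dm w0 (g v) -> z <= N -> z' <= N ->
  sat g (meq z z' u v) <-> val (g u) z = val (g v) z'.
Proof.
move=> du dv zN zN'; rewrite msat_and !msat_not !sat_lt //.
split=> [[/negP h1 /negP h2]|->]; last by rewrite ltnn.
by apply/eqP; rewrite eqn_leq leqNgt h2 leqNgt h1.
Qed.

Lemma sat_atom g r z1 z2 z3 v : dm w0 (g v) ->
  sat g (matom r z1 z2 z3 v) <-> atom (pf (g v)) r z1 z2 z3.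
Proof.
move=> dv; rewrite msat_bigor; split=> [[s]|h].
  by rewrite mem_filter => /andP[h _] /(sat_profile _ dv) <-.
by exists (pf (g v)); [rewrite mem_filter h mem_enum | apply/sat_profile].
Qed.

Definition variant z a a' : Prop :=
  forall z', 0 < z' -> z' <= N -> z' <> z -> val a z' = val a' z'.

Lemma sat_variant g z u v : dm w0 (g u) -> dm w0 (g v) ->
  sat g (mvariant z u v) <-> variant z (g u) (g v).
Proof.
move=> du dv; rewrite msat_bigand; split=> h z'.
  move=> z'0 z'N /eqP nz; have := h z'.
  by rewrite mem_filter nz mem_iota z'0 add1n ltnS z'N => /(_ erefl)/sat_eq; apply.
rewrite mem_filter mem_iota add1n ltnS => /and3P[/eqP nz z'0 z'N].
by apply/sat_eq => //; apply: h.
Qed.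

Lemma sat_minimum g z : 0 < z -> z <= N -> sat g (has_minimum z) <->
  forall a, dm w0 a -> exists a', dm w0 a' /\ variant z a a' /\
    forall c z', dm w0 c -> z' <= N -> val a' z <= val c z'.
Proof.
move=> z0 zN.
have body a a' : dm w0 a -> dm w0 a' ->
    sat (upd (upd g true a) false a') (MAnd (mvariant z true false)
      (MAll true (MBigAnd (iota 0 N.+1) (fun z' => MNot (mlt z' z true false))))) <->
    variant z a a' /\ forall c z', dm w0 c -> z' <= N -> val a' z <= val c z'.
  move=> da da'; rewrite msat_and sat_variant //.
  suff -> : sat (upd (upd g true a) false a')
      (MAll true (MBigAnd (iota 0 N.+1) (fun z' => MNot (mlt z' z true false)))) <->
      forall c z', dm w0 c -> z' <= N -> val a' z <= val c z' by [].
  rewrite msat_all; split=> h c.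
    move=> z' dc z'N; have /msat_bigand/(_ z') := h c dc.
    rewrite mem_iota add0n ltnS z'N => /(_ erefl)/msat_not.
    by rewrite sat_lt // => /negP; rewrite -leqNgt.
  move=> dc; apply/msat_bigand => z'; rewrite mem_iota add0n ltnS => z'N.
  by apply/msat_not; rewrite sat_lt //; apply/negP; rewrite -leqNgt; apply: h.
rewrite msat_all; split=> h a da.
  by have /msat_ex[a' [da' /body-/(_ da da')]] := h a da; exists a'.
apply/msat_ex; have [a' [da' h']] := h a da.
by exists a'; split=> //; apply/body.
Qed.

Lemma sat_successor g z : 0 < z -> z <= N -> sat g (has_successor z) <->
  forall a, dm w0 a -> exists a', dm w0 a' /\ variant z a a' /\
    val a z = val a' 0 /\ val a z < val a' z /\
    forall c z', dm w0 c -> z' <= N -> val a z < val c z' -> val a' z <= val c z'.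
Proof.
move=> z0 zN.
have body a a' : dm w0 a -> dm w0 a' ->
    sat (upd (upd g true a) false a') (MAnd
      (MAnd (mvariant z true false) (MAnd (meq z 0 true false) (mlt 0 z false false)))
      (MAll true (MBigAnd (iota 0 N.+1) (fun z' =>
         MNot (MAnd (mlt 0 z' false true) (mlt z' z true false)))))) <->
    variant z a a' /\ val a z = val a' 0 /\ val a z < val a' z /\
    forall c z', dm w0 c -> z' <= N -> val a z < val c z' -> val a' z <= val c z'.
  move=> da da'; rewrite msat_and msat_and msat_and sat_variant // sat_eq // sat_lt //.
  rewrite /upd /= -/(upd _ _ _).
  (* The inner quantifier rebinds the variable of [a], so the old value is available only as
     [val a' 0]. *)
  suff H : val a z = val a' 0 -> (sat (upd (upd g true a) false a')
      (MAll true (MBigAnd (iota 0 N.+1) (fun z' =>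
         MNot (MAnd (mlt 0 z' false true) (mlt z' z true false))))) <->
      forall c z', dm w0 c -> z' <= N -> val a z < val c z' -> val a' z <= val c z').
    split=> [[[hv [e lt]] /(H e) h] | [hv [e [lt h]]]]; first by rewrite -e in lt *.
    by rewrite -{2}e; split=> //; apply/H.
  move=> e; rewrite msat_all; split=> h c.
    move=> z' dc z'N; have /msat_bigand/(_ z') := h c dc.
    rewrite mem_iota add0n ltnS z'N => /(_ erefl)/msat_not.
    rewrite msat_and !sat_lt // /upd /= e => h' lt.
    by rewrite leqNgt; apply/negP=> lt'; apply: h'.
  move=> dc; apply/msat_bigand => z'; rewrite mem_iota add0n ltnS => z'N.
  apply/msat_not; rewrite msat_and !sat_lt // /upd /= -e => -[lt].
  by rewrite ltnNge h.
rewrite msat_all; split=> h a da.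
  by have /msat_ex[a' [da' /body-/(_ da da')]] := h a da; exists a'.
apply/msat_ex; have [a' [da' h']] := h a da.
by exists a'; split=> //; apply/body.
Qed.


Definition minimum_axiom z : Prop :=
  forall a, dm w0 a -> exists a', dm w0 a' /\ variant z a a' /\
    forall c z', dm w0 c -> z' <= N -> val a' z <= val c z'.

Definition successor_axiom z : Prop :=
  forall a, dm w0 a -> exists a', dm w0 a' /\ variant z a a' /\
    val a z = val a' 0 /\ val a z < val a' z /\
    forall c z', dm w0 c -> z' <= N -> val a z < val c z' -> val a' z <= val c z'.

Definition consistency_axiom r z1 z2 z3 : Prop :=
  forall a a', dm w0 a -> dm w0 a' ->
    val a z1 = val a' 1 -> val a z2 = val a' 2 -> val a z3 = val a' 3 ->
    (atom (pf a) r z1 z2 z3 <-> atom (pf a') r 1 2 3).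

Hypothesis three_le_N : 3 <= N.

Lemma sat_consistent g r z1 z2 z3 : z1 <= N -> z2 <= N -> z3 <= N ->
  sat g (consistent r z1 z2 z3) <-> consistency_axiom r z1 z2 z3.
Proof.
have [N1 N2] : 1 <= N /\ 2 <= N by split; apply: leq_trans three_le_N.
move=> z1N z2N z3N.
have body a a' : dm w0 a -> dm w0 a' ->
    sat (upd (upd g true a) false a') (MImp
      (MAnd (meq z1 1 true false) (MAnd (meq z2 2 true false) (meq z3 3 true false)))
      (MIff (matom r z1 z2 z3 true) (matom r 1 2 3 false))) <->
    (val a z1 = val a' 1 /\ val a z2 = val a' 2 /\ val a z3 = val a' 3 ->
    (atom (pf a) r z1 z2 z3 <-> atom (pf a') r 1 2 3)).
  move=> da da'; rewrite msat_imp msat_and msat_and msat_iff.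
  by rewrite !sat_eq // !sat_atom.
rewrite msat_all; split=> h a.
  by move=> a' da da' e1 e2 e3; have /body-> := h a da a' da'.
by move=> da; rewrite msat_all => a' da'; apply/body => // -[e1 [e2 e3]]; apply: h.
Qed.

Lemma sat_theory g : sat g theory <->
  (forall z, 0 < z -> z <= N -> minimum_axiom z /\ successor_axiom z) /\
  (forall r z1 z2 z3, r <= q -> 0 < z1 <= N -> 0 < z2 <= N -> 0 < z3 <= N ->
     consistency_axiom r z1 z2 z3).
Proof.
have mem z : (z \in iota 1 N) = (0 < z <= N) by rewrite mem_iota add1n ltnS.
have memr r : (r \in iota 0 q.+1) = (r <= q) by rewrite mem_iota add0n ltnS.
rewrite msat_and; split=> -[h1 h2]; split.
- move=> z z0 zN; have /msat_bigand/(_ z) := h1.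
  by rewrite mem z0 zN => /(_ erefl)/msat_and[/(sat_minimum _ z0 zN) ? /(sat_successor _ z0 zN) ?].
- move=> r z1 z2 z3; rewrite -memr -!mem => rq r1 r2 r3.
  have /msat_bigand/(_ r rq)/msat_bigand/(_ z1 r1)/msat_bigand/(_ z2 r2) := h2.
  move=> /msat_bigand/(_ z3 r3); move: r1 r2 r3; rewrite !mem.
  by move=> /andP[_ l1] /andP[_ l2] /andP[_ l3] /(sat_consistent _ _ l1 l2 l3).
- apply/msat_bigand => z; rewrite mem => /andP[z0 zN]; have [? ?] := h1 z z0 zN.
  by apply/msat_and; split; [apply/sat_minimum | apply/sat_successor].
- apply/msat_bigand => r; rewrite memr => rq; apply/msat_bigand => z1; rewrite mem => r1.
  apply/msat_bigand => z2; rewrite mem => r2; apply/msat_bigand => z3; rewrite mem => r3.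
  have := h2 _ _ _ _ rq r1 r2 r3.
  by move: r1 r2 r3 => /andP[_ ?] /andP[_ ?] /andP[_ ?] ?; apply/sat_consistent.
Qed.

Section Translation.
Variables (nu : nat -> nat) (rho : nat -> nat -> nat -> nat -> Prop).
Hypothesis nu_lt : forall m n, (nu m < nu n) = (m < n).
Hypothesis nu_onto : forall a z, dm w0 a -> 0 < z -> z <= N -> exists n, val a z = nu n.
Hypothesis all_variants : forall a z n, dm w0 a -> 0 < z -> z <= N ->
  exists a', dm w0 a' /\ variant z a a' /\ val a' z = nu n.
Hypothesis atom_rho : forall a r z1 z2 z3 n1 n2 n3, dm w0 a -> r <= q ->
  0 < z1 <= N -> 0 < z2 <= N -> 0 < z3 <= N ->
  val a z1 = nu n1 -> val a z2 = nu n2 -> val a z3 = nu n3 ->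
  (atom (pf a) r z1 z2 z3 <-> rho r n1 n2 n3).

(** One tuple holds the whole assignment, so after a quantifier the previous variable is free for
    reuse. A variant in one coordinate yields a number by [nu_onto], and each number yields a
    variant by [all_variants]. *)
Lemma sat_translate b v g e : rwidth b <= N -> rletters b <= q -> dm w0 (g v) ->
  (forall z, z < N -> val (g v) z.+1 = nu (e z)) ->
  sat g (translate v b) <-> rholds rho e b.
Proof.
elim: b v g e => [z z'|r z1 z2 z3||b IHb c IHc|z b IH] v g e.
- rewrite /= geq_max => /andP[zN zN'] _ dv val_e.
  by rewrite sat_lt // !val_e // nu_lt.
- rewrite /= !geq_max => /and3P[zN1 zN2 zN3] rq dv val_e.
  by rewrite sat_atom //; apply: atom_rho; rewrite ?val_e ?(ltnW rq).
- by [].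
- rewrite /= !geq_max => /andP[bN cN] /andP[bq cq] dv val_e.
  by rewrite (IHb _ _ e) // (IHc _ _ e).
- rewrite [rwidth _]/= [rletters _]/= geq_max => /andP[zN bN] bq dv val_e.
  have nv : v != ~~ v by case: v {dv val_e}.
  have upd_v a : upd g (~~ v) a v = g v by rewrite upd_other.
  have agree a n : dm w0 a -> variant z.+1 (g v) a -> val a z.+1 = nu n ->
      sat (upd g (~~ v) a) (translate (~~ v) b) <-> rholds rho (upd e z n) b.
    move=> da va an; apply: IH; rewrite ?upd_same // => z' zN'.
    rewrite /upd; case: eqP => [->|nz]; first by [].
    by rewrite -val_e // va // => -[].
  rewrite [translate _ _]/= msat_all rholds_all; split=> [h n|h a da].
    have [a [da [va an]]] := all_variants n dv (ltn0Sn z) zN.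
    apply/(agree a n) => //; have := h a da; rewrite msat_imp sat_variant ?upd_same ?upd_v //.
    exact.
  rewrite msat_imp sat_variant ?upd_same ?upd_v // => va.
  have [n an] := nu_onto da (ltn0Sn z) zN.
  by apply/(agree a n).
Qed.

End Translation.
End Semantics.
End Encoding.

Lemma functional_choice (A B : Type) (Q : A -> B -> Prop) :
  (forall a, exists b, Q a b) -> exists f, forall a, Q a (f a).
Proof.
move=> h; exists (fun a => proj1_sig (constructive_indefinite_description _ (h a))) => a.
exact: proj2_sig.
Qed.

(** * From modal models to relations *)

Section Enumeration.
Variables (N : nat) (D : Type) (dm : nat -> D -> Prop) (w0 : nat) (val : D -> nat -> nat).
Variable a0 : D.
Hypothesis dm_a0 : dm w0 a0.
Hypothesis N_gt0 : 0 < N.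
Hypothesis min_ax : forall z, 0 < z -> z <= N -> minimum_axiom N dm w0 val z.
Hypothesis succ_ax : forall z, 0 < z -> z <= N -> successor_axiom N dm w0 val z.

Definition next_value c c' : Prop :=
  c < c' /\ forall a z, dm w0 a -> z <= N -> c < val a z -> c' <= val a z.

(** Start from the minimum in coordinate 1 and iterate the successor axiom there; both axioms bound
    the values of all coordinates. *)
Lemma exists_enumeration : exists nu : nat -> nat,
  [/\ forall n, exists a, dm w0 a /\ val a 1 = nu n,
      forall a z, dm w0 a -> z <= N -> nu 0 <= val a z &
      forall n, next_value (nu n) (nu n.+1)].
Proof.
have [a1 [da1 [_ min1]]] := min_ax (ltn0Sn 0) N_gt0 dm_a0.
have nx_ex a : exists b, dm w0 a -> dm w0 b /\ next_value (val a 1) (val b 1).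
  case: (classic (dm w0 a)) => [da|nd]; last by exists a.
  by have [a' [da' [_ [_ h]]]] := succ_ax (ltn0Sn 0) N_gt0 da; exists a'.
have [nx hnx] := functional_choice nx_ex.
have d n : dm w0 (iter n nx a1) by elim: n => //= n /hnx[].
exists (fun n => val (iter n nx a1) 1); split=> [n|a z|n]; last by have [] := hnx _ (d n).
  by exists (iter n nx a1).
exact: min1.
Qed.

Variable nu : nat -> nat.
Hypothesis nu_value : forall n, exists a, dm w0 a /\ val a 1 = nu n.
Hypothesis nu_min : forall a z, dm w0 a -> z <= N -> nu 0 <= val a z.
Hypothesis nu_above : forall n, next_value (nu n) (nu n.+1).

Lemma enumeration_lt m n : (nu m < nu n) = (m < n).
Proof.
have mono : {homo nu : i j / i < j}.
  by apply: homo_ltn => [? ? ?|k]; [apply: ltn_trans | case: (nu_above k)].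
case: (ltngtP m n) => [/mono //|/mono nm|->]; last by rewrite ltnn.
by apply/negbTE; rewrite -leqNgt ltnW.
Qed.

(** A value missed by [nu] would exceed every [nu n]; but [n <= nu n], so it would exceed itself. *)
Lemma enumeration_onto a z : dm w0 a -> z <= N -> exists n, val a z = nu n.
Proof.
move=> da zN; have nu_ge n : n <= nu n.
  by elim: n => // n IH; case: (nu_above n) => lt _; apply: leq_ltn_trans lt.
have main n : (exists m, val a z = nu m) \/ nu n < val a z.
  elim: n => [|n [|lt]]; [|by left|].
    have := nu_min da zN; rewrite leq_eqVlt => /predU1P[e|]; last by right.
    by left; exists 0.
  have [_ /(_ _ _ da zN lt)] := nu_above n; rewrite leq_eqVlt => /predU1P[e|]; last by right.
  by left; exists n.+1.
by case: (main (val a z)) => // /(leq_ltn_trans (nu_ge _)); rewrite ltnn.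
Qed.

(** Climb in coordinate [z] from the minimum by successors. This meets the same values as coordinate
    1, because the axioms compare with all coordinates. *)
Lemma enumeration_variants a z n : dm w0 a -> 0 < z -> z <= N ->
  exists a', dm w0 a' /\ variant N val z a a' /\ val a' z = nu n.
Proof.
move=> da z0 zN; elim: n => [|n [a1 [da1 [va1 e1]]]].
  have [a' [da' [va' h]]] := min_ax z0 zN da; exists a'; split=> //; split=> //.
  by have [c [dc ec]] := nu_value 0; apply/eqP; rewrite eqn_leq nu_min // andbT -ec h.
have [a2 [da2 [va2 [_ [lt h]]]]] := succ_ax z0 zN da1.
exists a2; split=> //; split=> [z' p1 p2 p3|]; first by rewrite va1 // va2.
have [ltS hS] := nu_above n; rewrite e1 in lt h.
have [c [dc ec]] := nu_value n.+1.
by apply/eqP; rewrite eqn_leq hS // andbT -ec h // ec.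
Qed.

Lemma enumeration_triple a n1 n2 n3 : 3 <= N -> dm w0 a ->
  exists a', [/\ dm w0 a', val a' 1 = nu n1, val a' 2 = nu n2 & val a' 3 = nu n3].
Proof.
move=> N3 da; have [N1 N2] : 1 <= N /\ 2 <= N by split; apply: leq_trans N3.
have [a1 [da1 [_ e1]]] := enumeration_variants n1 da (ltn0Sn 0) N1.
have [a2 [da2 [v2 e2]]] := enumeration_variants n2 da1 (ltn0Sn 1) N2.
have [a3 [da3 [v3 e3]]] := enumeration_variants n3 da2 (ltn0Sn 2) N3.
by exists a3; split=> //; rewrite -v3 // -?v2.
Qed.

End Enumeration.

(** * Decoding an arbitrary model *)

Section Complete.
Variables (N q : nat) (D : Type) (dm P : nat -> D -> Prop) (w0 : nat).
Hypothesis three_le_N : 3 <= N.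

Lemma height_inj : injective (@height N q).
Proof. by move=> s s' /addnI /ord_inj /enum_rank_inj. Qed.

Lemma profile_unique w a (s s' : profile N q) :
  alternates P (height s) w a -> ~ alternates P (height s).+1 w a ->
  alternates P (height s') w a -> ~ alternates P (height s').+1 w a -> s = s'.
Proof.
move=> h1 h2 h1' h2'; apply: height_inj.
case: (ltngtP (height s) (height s')) => // lt.
  by case: h2; apply: alternates_le lt h1'.
by case: h2'; apply: alternates_le lt h1.
Qed.

Lemma well_formed_spec g : msat dm P w0 g (well_formed N q) ->
  exists (val : D -> nat -> nat) (pf : D -> profile N q),
    (forall a s, dm w0 a ->
      (alternates P (height s) w0 a /\ ~ alternates P (height s).+1 w0 a) <-> s = pf a) /\
    (forall a z w, dm w0 a -> z <= N ->
      alternates P (slot (pf a) z) w a <-> w < val a z).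
Proof.
move=> wf.
have pf_ex a : exists s : profile N q, dm w0 a ->
    alternates P (height s) w0 a /\ ~ alternates P (height s).+1 w0 a.
  case: (classic (dm w0 a)) => [da|nd]; last by exists ([ffun=> ord0], [ffun=> false]).
  have /msat_and[/msat_bigor[s _ hs] _] := msat_inst wf da.
  by exists s => _; move: hs; rewrite msat_and msat_not !msat_alternations upd_same.
have [pf hpf] := functional_choice pf_ex.
(* Pairs of an element and a coordinate, so that one choice yields the whole function [val]. *)
have val_ex p : exists n, dm w0 p.1 -> forall w, alternates P (slot (pf p.1) p.2) w p.1 <-> w < n.
  case: (classic (dm w0 p.1)) => [da|nd]; last by exists 0.
  have /msat_and[_ fin] := msat_inst wf da.
  (* From a point with no truth left, no higher count is possible either, so every slot has a
     threshold. *)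
  have [w hw] : exists w, ~ alternates P 0 w p.1.
    apply: NNPP => none; apply: fin => w _; apply: NNPP => hw; apply: none; exists w.
    by move=> h; apply/hw/(@msat_alternations _ dm P w (upd g true p.1) 0 true).
  have [n hn] : exists n, forall u, alternates P (slot (pf p.1) p.2) u p.1 <-> u < n.
    by apply: (@alternates_threshold _ _ _ w) => h; apply: hw; apply: alternates_le h.
  by exists n.
have [val hval] := functional_choice val_ex.
exists (fun a z => val (a, z)), pf; split=> [a s da|a z w da _]; last exact: (hval (a, z)).
have [h1 h2] := hpf a da.
by split=> [[h1' h2']|-> //]; apply: profile_unique h1' h2' h1 h2.
Qed.

Lemma mtop_complete g b : rwidth b <= N -> rletters b <= q ->
  msat dm P w0 g (mtop N q b) -> exists rho e, rholds rho e b.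
Proof.
move=> wb lb /msat_ex[a0 [da0 /msat_and[/msat_and[/well_formed_spec[val [pf [hpf hval]]] th] hb]]].
have [ax cons] := iffLR (sat_theory hpf hval three_le_N _) th.
have min_ax z : 0 < z -> z <= N -> minimum_axiom N dm w0 val z by move=> p r; case: (ax z p r).
have succ_ax z : 0 < z -> z <= N -> successor_axiom N dm w0 val z by move=> p r; case: (ax z p r).
have N0 : 0 < N by apply: leq_trans three_le_N.
have [nu [nu_value nu_min nu_above]] := exists_enumeration da0 N0 min_ax succ_ax.
(* Read off any element that has the three numbers in its reference coordinates; consistency makes
   the choice immaterial. *)
pose rho r n1 n2 n3 := exists a, [/\ dm w0 a, val a 1 = nu n1, val a 2 = nu n2,
  val a 3 = nu n3 & atom (pf a) r 1 2 3].
have onto := enumeration_onto nu_min nu_above.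
have variants := enumeration_variants N0 min_ax succ_ax nu_value nu_min nu_above.
have e_ex z : exists n, z < N -> val a0 z.+1 = nu n.
  case: (ltnP z N) => [zN|_]; last by exists 0.
  by have [n hn] := onto a0 z.+1 da0 zN; exists n.
have [e he] := functional_choice e_ex.
have onto' a z : dm w0 a -> 0 < z -> z <= N -> exists n, val a z = nu n.
  by move=> da _; apply: onto.
have atom_rho a r z1 z2 z3 n1 n2 n3 : dm w0 a -> r <= q ->
    0 < z1 <= N -> 0 < z2 <= N -> 0 < z3 <= N ->
    val a z1 = nu n1 -> val a z2 = nu n2 -> val a z3 = nu n3 ->
    (atom (pf a) r z1 z2 z3 <-> rho r n1 n2 n3).
  move=> da rq r1 r2 r3 e1 e2 e3; have cns := cons r z1 z2 z3 rq r1 r2 r3.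
  split=> [h|[a' [da' e1' e2' e3' h]]]; last first.
    by apply/(cns a a') => //; rewrite ?e1 ?e2 ?e3.
  have [a' [da' e1' e2' e3']] := enumeration_triple N0 min_ax succ_ax nu_value nu_min nu_above
    n1 n2 n3 three_le_N da.
  by exists a'; split=> //; apply/(cns a a') => //; rewrite ?e1 ?e2 ?e3.
have tr := sat_translate hpf hval (enumeration_lt nu_above) onto' variants atom_rho wb lb.
exists rho, e; apply: (iffLR (tr true (upd g true a0) e _ _) hb); rewrite ?upd_same //.
Qed.

End Complete.

(** * From relations to modal models *)

Section Descending.
Implicit Types (b : seq nat) (w j : nat).

(** In a decreasing list the entries above [w] come first. Beyond the end the default 0 exceeds no
    [w]. *)
Lemma ltn_nth_count b w j : pairwise gtn b -> (w < nth 0 b j) = (j < count (ltn w) b).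
Proof.
elim: b j => [|c b IH] j /=; first by rewrite nth_nil.
move=> /andP[/allP lt pw]; case: (ltnP w c) => wc.
  by case: j => [|j] /=; rewrite ?wc // add1n ltnS IH.
have c0 : count (ltn w) b = 0.
  apply/eqP; rewrite -leqn0 leqNgt -has_count; apply/hasPn => d /lt /= dc.
  by rewrite -leqNgt ltnW // (leq_trans dc).
by case: j => [|j]; rewrite c0 /= ?IH ?c0 // ltnNge wc.
Qed.

Lemma count_exact b w j : pairwise gtn b -> j < count (ltn w) b ->
  exists u, w <= u /\ count (ltn u) b = j.+1.
Proof.
move=> pw lt; have lt' := lt; rewrite -ltn_nth_count // in lt'.
(* Just below entry [j]: the entries up to [j] still exceed this point, the next one no longer
   does. *)
exists (nth 0 b j).-1; split; first by rewrite -ltnS prednK // (leq_ltn_trans _ lt').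
have pos : 0 < nth 0 b j := leq_ltn_trans (leq0n w) lt'.
apply/eqP; rewrite eqn_leq -ltn_nth_count // prednK // leqnn andbT.
rewrite leqNgt -ltn_nth_count // prednK // -ltnNge.
case: (ltnP j.+1 (size b)) => [jb|]; last by move/(nth_default 0) ->.
have jb' := ltnW jb.
by move/(pairwiseP 0): pw => /(_ j j.+1); apply.
Qed.

(** The letter has the parity of the number of entries ahead. A count that is at least [j] and
    differs from [j] in parity exceeds [j]; conversely [count_exact] finds points with each smaller
    positive count. *)
Lemma alternates_count (D : Type) (P : nat -> D -> Prop) a b j w :
  pairwise gtn b -> (forall u, P u a <-> odd (count (ltn u) b)) ->
  alternates P j w a <-> j < count (ltn w) b.
Proof.
move=> pw hP.
have anti u t : u <= t -> count (ltn t) b <= count (ltn u) b.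
  by move=> ut; apply: sub_count => c /=; apply: leq_ltn_trans.
elim: j w => [|j IH] w.
  split=> [[u [wu /hP]]|lt].
    by move=> od; apply: leq_trans (anti _ _ wu); apply: odd_gt0.
  have [u [wu cu]] := count_exact pw lt.
  by exists u; split=> //; apply/hP; rewrite cu.
split=> [[u [wu [od /IH lt]]]|lt].
  apply: leq_trans (anti _ _ wu); rewrite ltn_neqAle lt // andbT.
  apply/eqP => e; move: od; have := hP u; rewrite -e /=.
  by case: (odd j) => /= -[h1 h2] od; [apply: notF (h1 od) | apply: od (h2 isT)].
have [u [wu cu]] := count_exact pw lt.
exists u; split=> //; split; last by apply/IH; rewrite cu.
by have := hP u; rewrite cu /=; case: (odd j) => /= -[h1 h2]; [apply: h2 | move/h1].
Qed.

End Descending.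

(** * The model whose elements are all number sequences *)

Section Sound.
Variables (N q : nat) (rho : nat -> nat -> nat -> nat -> Prop).
Hypothesis three_le_N : 3 <= N.
Implicit Types (a : nat -> nat).

(* The values are shifted by [offset] to leave room below them for the
   alternations that only serve to encode the profile. *)
Definition offset : nat := (N.+1 + #|profile N q|).+1.

Definition value a z : nat := offset + a z.

(** Alternation times are distinct, so equal coordinates share one entry and one slot. *)
Definition values a : seq nat := sort geq (undup [seq value a z | z <- iota 0 N.+1]).

Definition profile_of a : profile N q :=
  ([ffun z : 'I_N.+1 => inord (index (value a z) (values a))],
   [ffun t : 'I_q.+1 * 'I_N.+1 * 'I_N.+1 * 'I_N.+1 =>
      if excluded_middle_informative (rho t.1.1.1 (a t.1.1.2) (a t.1.2) (a t.2))
      then true else false]).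

(** Brings the list to the length by which [has_profile] recognises the profile; the profile is
    fixed beforehand, so there is no circularity. *)
Definition padding a : nat := (height (profile_of a)).+1 - size (values a).

(** The padding starts at 1, so that every entry still lies ahead of the evaluation point 0. *)
Definition alternation_times a : seq nat := values a ++ rev (iota 1 (padding a)).

Definition letter_true w a : Prop := odd (count (ltn w) (alternation_times a)).

Lemma height_lt (s : profile N q) : height s < offset.
Proof. by rewrite ltnS leq_add2l ltnW. Qed.

Lemma size_values a : size (values a) <= N.+1.
Proof.
rewrite size_sort; apply: leq_trans (size_undup _) _.
by rewrite size_map size_iota.
Qed.

Lemma mem_values a z : z <= N -> value a z \in values a.
Proof.
move=> zN; rewrite mem_sort mem_undup; apply/mapP; exists z => //.
by rewrite mem_iota add0n ltnS zN.
Qed.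

Lemma offset_le_values a c : c \in values a -> offset <= c.
Proof. by rewrite mem_sort mem_undup => /mapP[z _ ->]; apply: leq_addr. Qed.

Lemma padding_le a : padding a < offset.
Proof.
rewrite /padding; apply: leq_trans (height_lt (profile_of a)).
rewrite ltnS leq_subLR -addn1 addnC leq_add2r.
(* Coordinate 0 contributes at least one value, which offsets the successor in [padding]. *)
by case: (values a) (mem_values a (leq0n N)).
Qed.

Lemma alternation_times_descending a : pairwise gtn (alternation_times a).
Proof.
have gtn_trans : transitive gtn by move=> ? ? ? /= h1 h2; apply: ltn_trans h2 h1.
rewrite pairwise_cat -!sorted_pairwise //; apply/and3P; split.
- apply/allrelP => c d /offset_le_values oc.
  rewrite mem_rev mem_iota add1n ltnS => /andP[_ dp] /=.
  by apply: leq_ltn_trans dp (leq_trans (padding_le a) oc).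
- rewrite gtn_sorted_uniq_geq sort_uniq undup_uniq sort_sorted // => m n.
  exact: leq_total.
- by rewrite rev_sorted; apply: iota_ltn_sorted.
Qed.

Lemma size_alternation_times a : size (alternation_times a) = (height (profile_of a)).+1.
Proof.
rewrite size_cat size_rev size_iota subnKC //.
by apply: leq_trans (size_values a) _; rewrite leqW // leq_addr.
Qed.

Lemma slot_profile_of a z : z <= N -> slot (profile_of a) z = index (value a z) (values a).
Proof.
move=> zN; rewrite /slot ffunE inordK inordK //.
by apply: leq_trans (size_values a); rewrite index_mem mem_values.
Qed.

Lemma atom_profile_of a r z1 z2 z3 : r <= q -> z1 <= N -> z2 <= N -> z3 <= N ->
  atom (profile_of a) r z1 z2 z3 <-> rho r (a z1) (a z2) (a z3).
Proof.
move=> rq z1N z2N z3N; rewrite /atom ffunE /= !inordK //.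
by case: excluded_middle_informative.
Qed.

Let dm (w : nat) (a : nat -> nat) : Prop := True.

Lemma alternates_letter_true j w a :
  alternates letter_true j w a <-> j < count (ltn w) (alternation_times a).
Proof. by apply: alternates_count => //; apply: alternation_times_descending. Qed.

Lemma profile_of_spec a (s : profile N q) : dm 0 a ->
  (alternates letter_true (height s) 0 a /\ ~ alternates letter_true (height s).+1 0 a) <->
  s = profile_of a.
Proof.
have all0 : count (ltn 0) (alternation_times a) = (height (profile_of a)).+1.
  rewrite -size_alternation_times; apply/eqP; rewrite -all_count; apply/allP => c.
  rewrite mem_cat => /orP[/offset_le_values|]; first exact: leq_trans.
  by rewrite mem_rev mem_iota => /andP[].
rewrite !alternates_letter_true all0 (ltnS (height s)) (ltnS (height s).+1) => _.
split=> [[le1 /negP]|->].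
  by rewrite -leqNgt => le2; apply/height_inj/eqP; rewrite eqn_leq le1.
by rewrite ltnn leqnn.
Qed.

Lemma value_spec a z w : dm 0 a -> z <= N ->
  alternates letter_true (slot (profile_of a) z) w a <-> w < value a z.
Proof.
move=> _ zN; rewrite alternates_letter_true -ltn_nth_count.
  by rewrite slot_profile_of // nth_cat index_mem mem_values // nth_index ?mem_values.
exact: alternation_times_descending.
Qed.

Lemma value_minimum_axiom z : minimum_axiom N dm 0 value z.
Proof.
move=> a _; exists (upd a z 0); split=> //; split=> [z' _ _ /eqP nz|c z' _ _].
  by rewrite /value upd_other.
by rewrite /value upd_same addn0 leq_addr.
Qed.

Lemma value_successor_axiom z : 0 < z -> successor_axiom N dm 0 value z.
Proof.
move=> z0 a _; have nz : 0 != z by rewrite neq_ltn z0.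
(* The scratch coordinate stores the old value, as [has_successor] requires. *)
exists (upd (upd a z (a z).+1) 0 (a z)); split=> //; rewrite /value; split.
  by move=> z' z'0 _ /eqP nz'; rewrite !upd_other // -lt0n.
rewrite upd_same upd_other 1?eq_sym // upd_same addnS ltnSn; split=> //; split=> //.
Qed.

Lemma value_consistency_axiom r z1 z2 z3 : r <= q -> z1 <= N -> z2 <= N -> z3 <= N ->
  consistency_axiom dm 0 value profile_of r z1 z2 z3.
Proof.
have [N1 N2] : 1 <= N /\ 2 <= N by split; apply: leq_trans three_le_N.
move=> rq z1N z2N z3N a a' _ _ /addnI e1 /addnI e2 /addnI e3.
by rewrite !atom_profile_of // e1 e2 e3.
Qed.

Lemma mtop_sound b g : rwidth b <= N -> rletters b <= q ->
  (forall e, rholds rho e b) -> msat dm letter_true 0 g (mtop N q b).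
Proof.
move=> wb lb hb; apply/msat_ex; exists (fun=> 0); split=> //.
apply/msat_and; split; first (apply/msat_and; split).
- rewrite msat_all => a _; apply/msat_and; split.
    apply/msat_bigor; exists (profile_of a); rewrite ?mem_enum //.
    by rewrite (sat_profile profile_of_spec) // upd_same.
  (* The largest alternation time: from there on the letter is false. *)
  set w := nth 0 (alternation_times a) 0; move=> /(_ w (leq0n _)).
  move/(@msat_alternations _ dm _ w _ 0 true); rewrite upd_same alternates_letter_true.
  by rewrite -ltn_nth_count ?ltnn //; apply: alternation_times_descending.
- apply/(sat_theory profile_of_spec value_spec three_le_N); split=> [z z0 _|r z1 z2 z3 rq].
    by split; [apply: value_minimum_axiom | apply: value_successor_axiom].
  by move=> /andP[_ ?] /andP[_ ?] /andP[_ ?]; apply: value_consistency_axiom.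
- have nu_lt m n : (offset + m < offset + n) = (m < n) by rewrite ltn_add2l.
  have nu_onto a z : dm 0 a -> 0 < z -> z <= N -> exists n, value a z = offset + n.
    by exists (a z).
  have variants a z n : dm 0 a -> 0 < z -> z <= N ->
      exists a', dm 0 a' /\ variant N value z a a' /\ value a' z = offset + n.
    exists (upd a z n); split=> //; split; last by rewrite /value upd_same.
    by move=> z' _ _ /eqP nz; rewrite /value upd_other.
  have atom_rho a r z1 z2 z3 n1 n2 n3 : dm 0 a -> r <= q ->
      0 < z1 <= N -> 0 < z2 <= N -> 0 < z3 <= N ->
      value a z1 = offset + n1 -> value a z2 = offset + n2 -> value a z3 = offset + n3 ->
      (atom (profile_of a) r z1 z2 z3 <-> rho r n1 n2 n3).
    move=> _ rq /andP[_ ?] /andP[_ ?] /andP[_ ?] /addnI <- /addnI <- /addnI <-.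
    exact: atom_profile_of.
  apply/(sat_translate profile_of_spec value_spec nu_lt nu_onto variants atom_rho wb lb
    (e := fun=> 0)) => //.
Qed.

End Sound.

(** * The reduction *)

Section Codes.
Variables x y i : nat.

Definition code_recursive (F : nat -> mform) : Prop :=
  recursive (fun v : 1.-tuple nat => code (embed x y i (F (thead v)))).

Lemma code_recursive_const f : code_recursive (fun=> f).
Proof. exact: rec_const. Qed.

Lemma code_recursive_imp F G : code_recursive F -> code_recursive G ->
  code_recursive (fun n => MImp (F n) (G n)).
Proof. by move=> hF hG; apply: rec_cpair (rec_const 1 2) (rec_cpair hF hG). Qed.

Lemma code_recursive_all v F : code_recursive F -> code_recursive (fun n => MAll v (F n)).
Proof. by move=> hF; apply: rec_cpair (rec_const 1 4) (rec_cpair (rec_const 1 _) hF). Qed.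

Lemma code_recursive_not F : code_recursive F -> code_recursive (fun n => MNot (F n)).
Proof. by move=> hF; apply: code_recursive_imp hF (code_recursive_const _). Qed.

Lemma code_recursive_and F G : code_recursive F -> code_recursive G ->
  code_recursive (fun n => MAnd (F n) (G n)).
Proof.
by move=> hF hG; apply/code_recursive_not/code_recursive_imp => //; apply: code_recursive_not.
Qed.

Variables N q : nat.

(** Translating [advance] wraps a fixed context around the translation of its argument. Its two
    quantifiers swap the modal variable twice, so the code is an iterate of the single function
    [F]. *)
Lemma code_recursive_advance v c b :
  code_recursive (fun n => translate N q v (iter n (advance c) b)).
Proof.
pose k1 := code (embed x y i (mvariant N q c.+2 v (~~ v))).
pose k2 := code (embed x y i (translate N q (~~ v) (RSucc c c.+1 c.+2))).
pose k3 := code (embed x y i (mvariant N q c.+1 (~~ v) (~~ ~~ v))).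
pose k4 := code (embed x y i (translate N q (~~ ~~ v) (REq c c.+1))).
pose F m := cpair 4 (cpair (variable x y (~~ v)) (cpair 2 (cpair k1 (cpair 2 (cpair k2
  (cpair 4 (cpair (variable x y (~~ ~~ v)) (cpair 2 (cpair k3 (cpair 2 (cpair k4 m))))))))))).
have hF : recursive (fun v : 1.-tuple nat => F (thead v)).
  by do 12! apply: rec_cpair (rec_const 1 _) _; exact: rec_thead.
apply: rec_ext (rec_iter (code (embed x y i (translate N q v b))) hF) _ => t.
elim: (thead t) => // n IH; rewrite !iterS IH /F.
have -> : translate N q v (iter n (advance c) b) = translate N q (~~ ~~ v) (iter n (advance c) b).
  by rewrite negbK.
by [].
Qed.

Lemma code_recursive_mtop a : code_recursive (fun n => mtop N q (sigma_form a n)).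
Proof.
apply/code_recursive_not/code_recursive_all/code_recursive_not.
apply: code_recursive_and; first exact: code_recursive_const.
apply: code_recursive_and; first exact: code_recursive_const.
apply: code_recursive_all; apply: code_recursive_imp; first exact: code_recursive_const.
apply: code_recursive_imp; first exact: code_recursive_const.
exact: code_recursive_advance.
Qed.

End Codes.

Theorem theorem2 (R : nat -> nat -> Prop)
    (lt_sub_R : forall m n : nat, m < n -> R m n)
    (R_sub_le : forall m n : nat, R m n -> m <= n)
    (L : formula -> Prop)
    (logic_exp_sub : forall phi : formula, logic_exp R phi -> L phi)
    (sub_logic_const : forall phi : formula, L phi -> logic_const R phi)
    (x y : nat) (neq_xy : x <> y) (i j : nat) :
  Sigma11_hard (fun phi : formula =>
    in_language x y i j phi /\ satisfiable_for L phi).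
Proof.
move=> A [a hA]; have [N [q bound]] := sigma_form_bounded a.
(* At least 3, to have room for the three reference coordinates. *)
pose K := maxn N 3; have K3 : 3 <= K by apply: leq_maxr.
have width n : rwidth (sigma_form a n) <= K by rewrite leq_max (bound n).1.
exists (fun n => embed x y i (mtop K q (sigma_form a n))).
split; first exact: code_recursive_mtop.
move=> n; split=> [/hA [S /sigma_form_sound [rho hrho]]|[_ sat]].
  split; first exact: embed_in_language.
  (* A constant domain, since [L] is included in [logic_const R]: a model of the formula here keeps
     its negation out of [L]. *)
  pose F := @PredFrame nat R (nat -> nat) (fun _ _ => True)
    (fun _ => ex_intro _ id I) (fun _ _ _ _ _ => I).
  pose M := @Model nat R F
    (fun w m _ t => if tval t is d :: _ then letter_true K q rho w d else False)
    (fun _ _ _ _ _ _ => I).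
  have hM : holds M 0 (fun _ => id) (embed x y i (mtop K q (sigma_form a n))).
    apply/(holds_embed i neq_xy lt_sub_R R_sub_le).
    exact: (mtop_sound K3 (width n) (bound n).2 hrho).
  move=> /sub_logic_const/(_ F M 0 (fun _ _ _ => conj id id) (fun _ => id) (fun _ _ => I)).
  by move/(_ hM).
(* If [A n] fails, no point of any model with expanding domains satisfies the formula, so its
   negation is in [logic_exp R] and hence in [L]. *)
apply: NNPP => nA; apply: sat; apply: logic_exp_sub => F M w g _.
suff: ~ holds M w g (embed x y i (mtop K q (sigma_form a n))) by [].
move=> /(holds_embed i neq_xy lt_sub_R R_sub_le).
move=> /(mtop_complete K3 (width n) (bound n).2)[rho [e he]].
by apply/nA/hA; apply: sigma_form_complete he.
Qed.
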